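(* Let $n\ge 2$ and let $P=(p_1,\dots,p_n)$, $Q=(q_1,\dots,q_n)$ be probability distributions with all $p_i>0$, $q_i>0$ and $\sum_i p_i=\sum_i q_i=1$. With the differences $D_{FB}=D_{FB}(P\|Q)$ defined in the context, $$D_{F\Psi}\le D_{FK_0}\le D_{FT}\le D_{FJ}\le D_{FM_3}\le D_{Fh}\le D_{FM_2}\le D_{FM_1}\le D_{FI}\le D_{F\Delta}$$ and $$D_{F\Delta}\le \tfrac98 D_{FI}\le \tfrac87 D_{FM_1}\le \tfrac{72}{61}D_{FM_2}\le \tfrac65 D_{Fh},$$ $$\tfrac65 D_{Fh}\le \tfrac97 D_{FJ}\le \tfrac32 D_{FK_0},\qquad \tfrac65 D_{Fh}\le \tfrac{24}{19}D_{FM_3}\le \tfrac32 D_{FK_0},$$ $$\tfrac32 D_{FK_0}\le \tfrac32 D_{FT}\le 3D_{F\Psi}.$$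
   Context: For $P,Q$ as in the claim define (all sums over $i=1,\dots,n$): $\Delta=\sum \frac{(p_i-q_i)^2}{p_i+q_i}$; $I=\frac12\left[\sum p_i\ln\frac{2p_i}{p_i+q_i}+\sum q_i\ln\frac{2q_i}{p_i+q_i}\right]$; $M_1=\sum\left[\sqrt{\frac{p_i+q_i}{2}}\,\frac{\sqrt{p_i}+\sqrt{q_i}}{2}-\left(\frac{\sqrt{p_i}+\sqrt{q_i}}{2}\right)^2\right]$; $M_2=\sum\left[\frac{\sqrt{p_i}+\sqrt{q_i}}{2}\sqrt{\frac{p_i+q_i}{2}}-\sqrt{p_iq_i}\right]$; $h=\frac12\sum(\sqrt{p_i}-\sqrt{q_i})^2$; $M_3=\sum\left[\frac{p_i+q_i}{2}-\frac{\sqrt{p_i}+\sqrt{q_i}}{2}\sqrt{\frac{p_i+q_i}{2}}\right]$; $J=\sum(p_i-q_i)\ln\frac{p_i}{q_i}$; $T=\sum\frac{p_i+q_i}{2}\ln\frac{p_i+q_i}{2\sqrt{p_iq_i}}$; $K_0=\sum\frac{(p_i-q_i)^2}{\sqrt{p_iq_i}}$; $\Psi=\sum\frac{(p_i-q_i)^2(p_i+q_i)}{p_iq_i}$; $F=\frac12\sum\frac{(p_i^2-q_i^2)^2}{\sqrt{(p_iq_i)^3}}$. Associate to these symbols the normalized quantities $\bar\Delta=\frac14\Delta$, $\bar I=I$, $\bar M_1=4M_1$, $\bar M_2=\frac43M_2$, $\bar h=h$, $\bar M_3=4M_3$, $\bar J=\frac18J$, $\bar T=T$, $\bar K_0=\frac18K_0$,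 $\bar\Psi=\frac1{16}\Psi$, $\bar F=\frac1{16}F$. For two symbols $A,B$ put $D_{AB}=D_{AB}(P\|Q):=\bar A-\bar B$; e.g. $D_{FI}=\frac1{16}F-I$, $D_{F\Psi}=\frac1{16}F-\frac1{16}\Psi$. *)

(* Defs.v *)
From Stdlib Require Import Reals.
Open Scope R_scope.

(* Over the Stdlib reals, a vector (p_1, ..., p_n) is a function p : nat -> R of
   which only the values at 1, ..., n are used; for 1 <= n, [sum_f 1 n f] is f 1 + ... + f n. *)

Definition positive_distribution (n : nat) (p : nat -> R) : Prop :=
  (forall i : nat, (1 <= i <= n)%nat -> 0 < p i) /\ sum_f 1 n p = 1.

(* The prefix s avoids clashes with Stdlib names, e.g. I : True. *)
Inductive symbol : Set :=
  | sDelta | sI | sM1 | sM2 | sh | sM3 | sJ | sT | sK0 | sPsi | sF.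

Definition measure (A : symbol) (n : nat) (p q : nat -> R) : R :=
  match A with
  | sDelta => sum_f 1 n (fun i => (p i - q i) ^ 2 / (p i + q i))
  | sI => 1 / 2 *
      (sum_f 1 n (fun i => p i * ln (2 * p i / (p i + q i))) +
       sum_f 1 n (fun i => q i * ln (2 * q i / (p i + q i))))
  | sM1 => sum_f 1 n (fun i =>
      sqrt ((p i + q i) / 2) * ((sqrt (p i) + sqrt (q i)) / 2)
      - ((sqrt (p i) + sqrt (q i)) / 2) ^ 2)
  | sM2 => sum_f 1 n (fun i =>
      (sqrt (p i) + sqrt (q i)) / 2 * sqrt ((p i + q i) / 2)
      - sqrt (p i * q i))
  | sh => 1 / 2 * sum_f 1 n (fun i => (sqrt (p i) - sqrt (q i)) ^ 2)
  | sM3 => sum_f 1 n (fun i =>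
      (p i + q i) / 2
      - (sqrt (p i) + sqrt (q i)) / 2 * sqrt ((p i + q i) / 2))
  | sJ => sum_f 1 n (fun i => (p i - q i) * ln (p i / q i))
  | sT => sum_f 1 n (fun i =>
      (p i + q i) / 2 * ln ((p i + q i) / (2 * sqrt (p i * q i))))
  | sK0 => sum_f 1 n (fun i => (p i - q i) ^ 2 / sqrt (p i * q i))
  | sPsi => sum_f 1 n (fun i =>
      (p i - q i) ^ 2 * (p i + q i) / (p i * q i))
  | sF => 1 / 2 * sum_f 1 n (fun i =>
      (p i ^ 2 - q i ^ 2) ^ 2 / sqrt ((p i * q i) ^ 3))
  end.

Definition weight (A : symbol) : R :=
  match A with
  | sDelta => 1 / 4
  | sI => 1
  | sM1 => 4
  | sM2 => 4 / 3
  | sh => 1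
  | sM3 => 4
  | sJ => 1 / 8
  | sT => 1
  | sK0 => 1 / 8
  | sPsi => 1 / 16
  | sF => 1 / 16
  end.

Definition normalized (A : symbol) (n : nat) (p q : nat -> R) : R :=
  weight A * measure A n p q.

Definition D (A B : symbol) (n : nat) (p q : nat -> R) : R :=
  normalized A n p q - normalized B n p q.

(* Main.v *)
From Stdlib Require Import Reals Lra Lia.
From Coquelicot Require Import Coquelicot.
Require Import Defs.
Open Scope R_scope.

(* Every inequality holds summand by summand. With [c = (sqrt p + sqrt q) / 2] and
   [z = (sqrt p - sqrt q) / (sqrt p + sqrt q)] one has [p = c^2 (1 + z)^2] and
   [q = c^2 (1 - z)^2], so each normalized summand is [c^2] times an even function of
   [z] (its profile), built from rational functions of [z^2], [s = sqrt (1 + z^2)] and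
   [L z = ln ((1 + z) / (1 - z))].
   The constants 9/8, 8/7, ... make each three-term combination vanish to order [z^6] at [0],
   so second-order bounds suffice:
   [2 z (1 + z^2/3) <= L z <= 2 z (1 + z^2/3 + z^4 / (5 (1 - z^2)))] and
   [1 + z^2/2 - z^4/8 <= s <= 1 + z^2/2] reduce the inequalities to the positivity of
   explicit polynomials in [z^2] on [[0, 1)]. Those that involve I, which contains both
   [L z] and [L (z^2)], as well as J <= T, are differentiated first after dividing by
   [1 + z^2], which leaves only [L z]. *)

(** * Elementary bounds for the logarithm and the square root *)

Lemma nonneg_of_derive_nonneg (f f' : R -> R) (z : R) :
  0 <= z < 1 -> f 0 = 0 ->
  (forall x, 0 <= x < 1 -> is_derive f x (f' x)) ->
  (forall x, 0 <= x < 1 -> 0 <= f' x) ->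
  0 <= f z.
Proof.
intros hz f0 df f'ge0.
destruct (MVT_gen f 0 z f') as [c [hc e]].
- intros x hx; rewrite Rmin_left, Rmax_right in hx by lra; apply df; lra.
- intros x hx; rewrite Rmin_left, Rmax_right in hx by lra.
  apply continuity_pt_filterlim, (ex_derive_continuous f x).
  exists (f' x); apply df; lra.
- rewrite Rmin_left, Rmax_right in hc by lra.
  assert (0 <= f' c) by (apply f'ge0; lra).
  rewrite f0 in e; nra.
Qed.

(** This is [2 artanh z = 2 (z + z^3/3 + z^5/5 + ...)]; the bounds below come from this series. *)
Definition logratio (z : R) : R := ln ((1 + z) / (1 - z)).

Lemma logratio0 : logratio 0 = 0.
Proof.
unfold logratio; replace ((1 + 0) / (1 - 0)) with 1 by field; exact ln_1.
Qed.

Lemma logratio_opp (z : R) : -1 < z < 1 -> logratio (- z) = - logratio z.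
Proof.
intros hz; unfold logratio.
rewrite <- ln_Rinv by (apply Rdiv_lt_0_compat; lra).
f_equal; field; lra.
Qed.

Lemma is_derive_logratio (z : R) :
  -1 < z < 1 -> is_derive logratio z (2 / (1 - z ^ 2)).
Proof.
intros hz; unfold logratio; auto_derive.
- repeat split; try lra; apply Rdiv_lt_0_compat; lra.
- field; repeat split; nra.
Qed.

Lemma ex_derive_logratio (z : R) : -1 < z < 1 -> ex_derive (fun x => logratio x) z.
Proof. intros hz; eexists; apply is_derive_logratio, hz. Qed.

Lemma Derive_logratio (z : R) :
  -1 < z < 1 -> Derive (fun x : R => logratio x) z = 2 / (1 - z ^ 2).
Proof. intros hz; apply is_derive_unique, is_derive_logratio, hz. Qed.

Lemma logratio_ge (z : R) : 0 <= z < 1 -> 2 * z * (1 + z ^ 2 / 3) <= logratio z.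
Proof.
intros hz; apply Rminus_le_0.
apply (nonneg_of_derive_nonneg (fun x => logratio x - 2 * x * (1 + x ^ 2 / 3))
         (fun x => 2 * x ^ 4 / (1 - x ^ 2))); trivial.
- rewrite logratio0; ring.
- intros x hx; evar_last.
  + apply (is_derive_minus logratio _ x); [apply is_derive_logratio; lra | auto_derive; trivial].
  + unfold minus, plus, opp; simpl; field; nra.
- intros x hx; apply Rdiv_le_0_compat; nra.
Qed.

(** In the series, every coefficient from [z^5] on is at most [2/5], so the tail is bounded by a
    geometric series of ratio [z^2]. *)
Lemma logratio_le (z : R) : 0 <= z < 1 ->
  logratio z <= 2 * z * (1 + z ^ 2 / 3 + z ^ 4 / (5 * (1 - z ^ 2))).
Proof.
intros hz; apply Rminus_le_0.
apply (nonneg_of_derive_nonneg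
         (fun x => 2 * x * (1 + x ^ 2 / 3 + x ^ 4 / (5 * (1 - x ^ 2))) - logratio x)
         (fun x => 4 * x ^ 6 / (5 * (1 - x ^ 2) ^ 2))); trivial.
- rewrite logratio0; field.
- intros x hx; evar_last.
  + apply (is_derive_minus _ logratio x); [auto_derive; [|reflexivity] | apply is_derive_logratio; lra].
    nra.
  + unfold minus, plus, opp; simpl; field; nra.
- intros x hx; apply Rdiv_le_0_compat; [|assert (0 < 1 - x^2) by nra; assert (0 < (1-x^2)^2) by (apply pow_lt; lra); lra].
  assert (0 <= x ^ 6) by (apply pow_le; lra); lra.
Qed.

Lemma sqrt_1_plus_bounds (x : R) : 0 <= x <= 1 ->
  1 + x / 2 - x ^ 2 / 8 <= sqrt (1 + x) <= 1 + x / 2.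
Proof.
intros hx; split.
(* The square of this Taylor polynomial is [1 + x - x^3/8 + x^4/64], which is at most [1 + x] on
   [[0, 1]]. *)
- rewrite <- (sqrt_pow2 (1 + x / 2 - x ^ 2 / 8)) by nra.
  apply sqrt_le_1_alt; nra.
- rewrite <- (sqrt_pow2 (1 + x / 2)) by lra.
  apply sqrt_le_1_alt; nra.
Qed.

(** * Reduction of the sums to functions of one variable *)

Definition profile (A : symbol) (z : R) : R :=
  match A with
  | sDelta => 2 * z ^ 2 / (1 + z ^ 2)
  | sI => 2 * z * logratio z - (1 + z ^ 2) * logratio (z ^ 2)
  | sM1 => 4 * (sqrt (1 + z ^ 2) - 1)
  | sM2 => 4 / 3 * (sqrt (1 + z ^ 2) - 1 + z ^ 2)
  | sh => 2 * z ^ 2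
  | sM3 => 4 * (1 + z ^ 2 - sqrt (1 + z ^ 2))
  | sJ => z * logratio z
  | sT => (1 + z ^ 2) * logratio (z ^ 2)
  | sK0 => 2 * z ^ 2 / (1 - z ^ 2)
  | sPsi => 2 * z ^ 2 * (1 + z ^ 2) / (1 - z ^ 2) ^ 2
  | sF => 2 * z ^ 2 * (1 + z ^ 2) ^ 2 / (1 - z ^ 2) ^ 3
  end.

Definition summand (A : symbol) (p q : R) : R :=
  match A with
  | sDelta => (p - q) ^ 2 / (p + q)
  | sI => 1 / 2 * (p * ln (2 * p / (p + q)) + q * ln (2 * q / (p + q)))
  | sM1 => sqrt ((p + q) / 2) * ((sqrt p + sqrt q) / 2) - ((sqrt p + sqrt q) / 2) ^ 2
  | sM2 => (sqrt p + sqrt q) / 2 * sqrt ((p + q) / 2) - sqrt (p * q)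
  | sh => 1 / 2 * (sqrt p - sqrt q) ^ 2
  | sM3 => (p + q) / 2 - (sqrt p + sqrt q) / 2 * sqrt ((p + q) / 2)
  | sJ => (p - q) * ln (p / q)
  | sT => (p + q) / 2 * ln ((p + q) / (2 * sqrt (p * q)))
  | sK0 => (p - q) ^ 2 / sqrt (p * q)
  | sPsi => (p - q) ^ 2 * (p + q) / (p * q)
  | sF => 1 / 2 * ((p ^ 2 - q ^ 2) ^ 2 / sqrt ((p * q) ^ 3))
  end.

Lemma summand_profile (A : symbol) (c z : R) : 0 < c -> -1 < z < 1 ->
  weight A * summand A (c ^ 2 * (1 + z) ^ 2) (c ^ 2 * (1 - z) ^ 2) =
  c ^ 2 * profile A z.
Proof.
intros hc hz.
assert (hW : 0 < 1 - z ^ 2) by nra.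
assert (hV : 0 < 1 + z ^ 2) by nra.
assert (hc2 : 0 < c ^ 2) by (apply pow_lt; lra).
assert (hp2 : 0 < (1 + z) ^ 2) by (apply pow_lt; lra).
assert (hq2 : 0 < (1 - z) ^ 2) by (apply pow_lt; lra).
assert (ep : sqrt (c ^ 2 * (1 + z) ^ 2) = c * (1 + z)).
{ rewrite <- Rpow_mult_distr; apply sqrt_pow2; nra. }
assert (eq : sqrt (c ^ 2 * (1 - z) ^ 2) = c * (1 - z)).
{ rewrite <- Rpow_mult_distr; apply sqrt_pow2; nra. }
assert (epq : sqrt (c ^ 2 * (1 + z) ^ 2 * (c ^ 2 * (1 - z) ^ 2)) = c ^ 2 * (1 - z ^ 2)).
{ rewrite <- (sqrt_pow2 (c ^ 2 * (1 - z ^ 2))) by nra; f_equal; ring. }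
assert (es : sqrt ((c ^ 2 * (1 + z) ^ 2 + c ^ 2 * (1 - z) ^ 2) / 2) = c * sqrt (1 + z ^ 2)).
{ replace ((c ^ 2 * (1 + z) ^ 2 + c ^ 2 * (1 - z) ^ 2) / 2)
    with (c ^ 2 * (1 + z ^ 2)) by field.
  rewrite sqrt_mult by lra; rewrite sqrt_pow2 by lra; reflexivity. }
assert (epq3 : sqrt ((c ^ 2 * (1 + z) ^ 2 * (c ^ 2 * (1 - z) ^ 2)) ^ 3) =
               (c ^ 2 * (1 - z ^ 2)) ^ 3).
{ rewrite <- (sqrt_pow2 ((c ^ 2 * (1 - z ^ 2)) ^ 3)).
  - f_equal; ring.
  - apply pow_le; nra. }
assert (L2 : logratio (z ^ 2) = ln (1 + z ^ 2) - ln (1 + z) - ln (1 - z)).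
{ unfold logratio; rewrite ln_div by lra.
  replace (1 - z ^ 2) with ((1 + z) * (1 - z)) by ring.
  rewrite ln_mult by lra; ring. }
assert (L1 : logratio z = ln (1 + z) - ln (1 - z)).
{ unfold logratio; rewrite ln_div by lra; ring. }
assert (lnsq : forall x, 0 < x -> ln (x ^ 2) = 2 * ln x).
{ intros x hx; simpl; rewrite Rmult_1_r, ln_mult by lra; ring. }
destruct A; unfold weight, summand, profile;
  rewrite ?ep, ?eq, ?es, ?epq3, ?epq; try (field; repeat split; nra).
(* The symbols without logarithms are settled by [field]; I, J and T remain, and [c] cancels in the
   argument of each logarithm. *)
- replace (2 * (c ^ 2 * (1 + z) ^ 2) / (c ^ 2 * (1 + z) ^ 2 + c ^ 2 * (1 - z) ^ 2))
    with ((1 + z) ^ 2 / (1 + z ^ 2)) by (field; repeat split; nra).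
  replace (2 * (c ^ 2 * (1 - z) ^ 2) / (c ^ 2 * (1 + z) ^ 2 + c ^ 2 * (1 - z) ^ 2))
    with ((1 - z) ^ 2 / (1 + z ^ 2)) by (field; repeat split; nra).
  rewrite !ln_div, !lnsq, L1, L2 by lra; field.
- replace (c ^ 2 * (1 + z) ^ 2 / (c ^ 2 * (1 - z) ^ 2))
    with ((1 + z) ^ 2 / (1 - z) ^ 2) by (field; lra).
  rewrite ln_div, !lnsq, L1 by lra; field.
- replace ((c ^ 2 * (1 + z) ^ 2 + c ^ 2 * (1 - z) ^ 2) / (2 * (c ^ 2 * (1 - z ^ 2))))
    with ((1 + z ^ 2) / (1 - z ^ 2)) by (field; nra).
  unfold logratio; field.
Qed.

(** A change of sign of [z] exchanges [p] and [q], and all the measures are symmetric. This is why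
    bounds for [z >= 0] suffice. *)
Lemma profile_opp (A : symbol) (z : R) : -1 < z < 1 -> profile A (- z) = profile A z.
Proof.
intros hz.
assert (e2 : (- z) ^ 2 = z ^ 2) by ring.
destruct A; unfold profile; rewrite ?e2, ?logratio_opp by lra; ring.
Qed.

Lemma normalized_eq_sum (A : symbol) (n : nat) (p q : nat -> R) :
  normalized A n p q = sum_f 1 n (fun i => weight A * summand A (p i) (q i)).
Proof.
assert (scal : forall c f, sum_f 1 n (fun i => c * f i) = c * sum_f 1 n f).
{ intros c f; unfold sum_f; rewrite scal_sum; apply sum_eq; intros; ring. }
assert (add : forall f g, sum_f 1 n (fun i => f i + g i) = sum_f 1 n f + sum_f 1 n g).
{ intros f g; unfold sum_f; apply plus_sum. }
unfold normalized; rewrite scal.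
destruct A; unfold measure, summand; rewrite ?scal, ?add; reflexivity.
Qed.

Lemma normalized_combination_nonneg (A B C : symbol) (a b c : R)
  (n : nat) (p q : nat -> R) :
  (1 <= n)%nat ->
  (forall i, (1 <= i <= n)%nat -> 0 < p i) ->
  (forall i, (1 <= i <= n)%nat -> 0 < q i) ->
  (forall z, 0 <= z < 1 -> 0 <= a * profile A z + b * profile B z + c * profile C z) ->
  0 <= a * normalized A n p q + b * normalized B n p q + c * normalized C n p q.
Proof.
intros hn hp hq H.
rewrite !normalized_eq_sum; unfold sum_f; rewrite !scal_sum, <- !plus_sum.
(* Zero is written as a sum of [n] zeros, to compare the sums term by term. *)
rewrite <- (Rmult_0_l (INR (S (n - 1)))), <- sum_cte.
apply sum_Rle; intros k hk.
(* [sum_f 1 n] unfolds to a sum over [k <= n - 1] of the terms of index [k + 1]; [1 <= n] keeps this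
   index within [1..n] despite truncated subtraction. *)
assert (hpk : 0 < p (k + 1)%nat) by (apply hp; lia).
assert (hqk : 0 < q (k + 1)%nat) by (apply hq; lia).
revert hpk hqk; generalize (p (k + 1)%nat) (q (k + 1)%nat); clear - H.
intros u v hu hv.
assert (hsu := sqrt_lt_R0 u hu); assert (hsv := sqrt_lt_R0 v hv).
set (r := (sqrt u + sqrt v) / 2).
set (z := (sqrt u - sqrt v) / (sqrt u + sqrt v)).
assert (hr : 0 < r) by (unfold r; lra).
assert (hz : -1 < z < 1).
{ unfold z; split; [apply Rlt_div_r | apply Rlt_div_l]; lra. }
assert (eu : u = r ^ 2 * (1 + z) ^ 2).
{ rewrite <- (pow2_sqrt u) at 1 by lra; unfold r, z; field; lra. }
assert (ev : v = r ^ 2 * (1 - z) ^ 2).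
{ rewrite <- (pow2_sqrt v) at 1 by lra; unfold r, z; field; lra. }
clearbody r z; subst u v.
rewrite !summand_profile by lra.
assert (hz' : 0 <= a * profile A z + b * profile B z + c * profile C z).
{ destruct (Rle_lt_dec 0 z).
  - apply H; lra.
  - rewrite <- (profile_opp A), <- (profile_opp B), <- (profile_opp C) by lra.
    apply H; lra. }
assert (0 < r ^ 2) by (apply pow_lt; lra).
nra.
Qed.

Lemma normalized_le (A B : symbol) (n : nat) (p q : nat -> R) :
  (1 <= n)%nat ->
  (forall i, (1 <= i <= n)%nat -> 0 < p i) ->
  (forall i, (1 <= i <= n)%nat -> 0 < q i) ->
  (forall z, 0 <= z < 1 -> profile A z <= profile B z) ->
  normalized A n p q <= normalized B n p q.
Proof.
intros hn hp hq H.
assert (0 <= -1 * normalized A n p q + 1 * normalized B n p q + 0 * normalized B n p q).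
{ apply normalized_combination_nonneg; trivial.
  intros z hz; specialize (H z hz); lra. }
lra.
Qed.

Lemma sqr_bounds (z : R) : 0 <= z < 1 -> 0 <= z ^ 2 < 1.
Proof. intros hz; split; nra. Qed.

(** * Pairwise comparison of profiles, first those needing no derivative of I *)

Lemma profile_K0_le_Psi (z : R) : 0 <= z < 1 -> profile sK0 z <= profile sPsi z.
Proof.
intros hz; apply sqr_bounds in hz; unfold profile.
revert hz; generalize (z ^ 2); intros x hx; apply Rminus_le_0.
replace (_ - _) with (4 * x ^ 2 / (1 - x) ^ 2) by (field; lra).
apply Rdiv_le_0_compat; [nra | apply pow_lt; lra].
Qed.

Lemma profile_T_le_K0 (z : R) : 0 <= z < 1 -> profile sT z <= profile sK0 z.
Proof.
intros hz; apply sqr_bounds in hz; unfold profile.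
revert hz; generalize (z ^ 2); intros x hx; apply Rminus_le_0.
apply Rle_trans with (2 * x / (1 - x) -
  (1 + x) * (2 * x * (1 + x ^ 2 / 3 + x ^ 4 / (5 * (1 - x ^ 2))))).
2:{ assert (h := logratio_le x hx); nra. }
replace (_ - _) with (2 * x ^ 3 * (10 + 2 * x ^ 2) / (15 * (1 - x)))
  by (field; split; nra).
apply Rdiv_le_0_compat; [|lra].
assert (0 <= x ^ 3) by (apply pow_le; lra); nra.
Qed.

Lemma profile_J_le_T (z : R) : 0 <= z < 1 -> profile sJ z <= profile sT z.
Proof.
intros hz; unfold profile.
assert (h : 0 <= logratio (z ^ 2) - z * logratio z / (1 + z ^ 2)).
{ apply (nonneg_of_derive_nonneg
           (fun x => logratio (x ^ 2) - x * logratio x / (1 + x ^ 2))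
           (fun x => (1 - x ^ 2) / (1 + x ^ 2) ^ 2 *
              (2 * x * (1 + x ^ 2) / (1 - x ^ 2) ^ 2 - logratio x))); trivial.
  - replace (0 ^ 2) with 0 by ring; rewrite logratio0; field.
  - intros x hx; assert (0 <= x ^ 2 < 1) by (apply sqr_bounds; lra).
    auto_derive.
    + repeat split; (try apply ex_derive_logratio); nra.
    + rewrite !Derive_logratio by nra.
      field; repeat split; nra.
  - intros x hx; assert (hx2 := sqr_bounds x hx).
    apply Rmult_le_pos.
    + apply Rdiv_le_0_compat; [lra | apply pow_lt; lra].
    (* The logarithm now enters only with a minus sign, so its upper bound leaves a rational
       inequality in [w = x^2]. *)
    + assert (h := logratio_le x hx).
      apply Rle_trans with (2 * x * (1 + x ^ 2) / (1 - x ^ 2) ^ 2 -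
        2 * x * (1 + x ^ 2 / 3 + x ^ 4 / (5 * (1 - x ^ 2)))); [|lra].
      replace (x ^ 4) with ((x ^ 2) ^ 2) by ring.
      revert hx2; generalize (x ^ 2); intros w hw.
      replace (_ - _) with (2 * x * (w * (40 - 8 * w - 2 * w ^ 2)) / (15 * (1 - w) ^ 2))
        by (field; lra).
      apply Rdiv_le_0_compat.
      * repeat apply Rmult_le_pos; nra.
      * assert (0 < (1 - w) ^ 2) by (apply pow_lt; lra); lra. }
assert (e : (1 + z ^ 2) * (z * logratio z / (1 + z ^ 2)) = z * logratio z) by (field; nra).
nra.
Qed.

(** With [w = z^2], the lower bound on [s] bounds M3 by [2 w + w^2/2], while J is at least
    [2 w + 2 w^2/3]. *)
Lemma profile_M3_le_J (z : R) : 0 <= z < 1 -> profile sM3 z <= profile sJ z.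
Proof.
intros hz; assert (hw := sqr_bounds z hz); unfold profile.
assert (hs := sqrt_1_plus_bounds (z ^ 2) ltac:(lra)).
assert (es := pow2_sqrt (1 + z ^ 2) ltac:(lra)).
assert (hl := logratio_ge z hz).
revert hs es; generalize (sqrt (1 + z ^ 2)); intros s hs es.
apply Rle_trans with (2 * z ^ 2 * (1 + z ^ 2 / 3)); [|nra].
revert hw hs es; generalize (z ^ 2); intros w hw hs es.
nra.
Qed.

(** The difference is [2 (s - 1)^2] with [s = sqrt (1 + z^2)]. *)
Lemma profile_h_le_M3 (z : R) : profile sh z <= profile sM3 z.
Proof.
unfold profile; assert (hw := pow2_ge_0 z).
assert (es := pow2_sqrt (1 + z ^ 2) ltac:(lra)).
nra.
Qed.

(** The gap is [(s - 1)^2]; the next two comparisons are this one times [2/3] and [4/3]. *)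
Lemma sqrt_1_plus_le (z : R) : 2 * (sqrt (1 + z ^ 2) - 1) <= z ^ 2.
Proof.
assert (hw := pow2_ge_0 z).
assert (es := pow2_sqrt (1 + z ^ 2) ltac:(lra)).
nra.
Qed.

Lemma profile_M2_le_h (z : R) : profile sM2 z <= profile sh z.
Proof. unfold profile; assert (h := sqrt_1_plus_le z); lra. Qed.

Lemma profile_M1_le_M2 (z : R) : profile sM1 z <= profile sM2 z.
Proof. unfold profile; assert (h := sqrt_1_plus_le z); lra. Qed.

(** * Differentiation after division by [1 + z^2], and the comparisons of I with Delta and M1 *)

Lemma is_derive_profile_Delta (z : R) : 0 <= z < 1 ->
  is_derive (fun x => profile sDelta x / (1 + x ^ 2)) z
    (4 * z * (1 - z ^ 2) / (1 + z ^ 2) ^ 3).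
Proof.
intros hz; unfold profile; auto_derive; [nra | field; nra].
Qed.

Lemma is_derive_profile_F (z : R) : 0 <= z < 1 ->
  is_derive (fun x => profile sF x / (1 + x ^ 2)) z
    (4 * z * (1 + 4 * z ^ 2 + z ^ 4) / (1 - z ^ 2) ^ 4).
Proof.
intros hz; unfold profile.
assert (0 < (1 - z ^ 2) ^ 3) by (apply pow_lt; nra).
auto_derive; [split; [simpl in *; lra | nra] | field; nra].
Qed.

Lemma is_derive_profile_M1 (z : R) : 0 <= z < 1 ->
  is_derive (fun x => profile sM1 x / (1 + x ^ 2)) z
    (4 * z * (2 - sqrt (1 + z ^ 2)) / (1 + z ^ 2) ^ 2).
Proof.
intros hz; unfold profile; assert (hw := pow2_ge_0 z).
assert (es := pow2_sqrt (1 + z ^ 2) ltac:(lra)).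
assert (hs := sqrt_lt_R0 (1 + z ^ 2) ltac:(lra)).
auto_derive; [nra|].
replace (1 + z * (z * 1)) with (1 + z ^ 2) by ring.
revert es hs; generalize (sqrt (1 + z ^ 2)); intros s es hs.
(* Writing [1 + z^2] as [s^2] makes the identity rational in [s] and [z]. *)
rewrite <- es; field; lra.
Qed.

(** The derivative [4 z / (1 - z^4)] of [logratio (z ^ 2)] cancels the rational part coming from
    [logratio z]. *)
Lemma is_derive_profile_I (z : R) : 0 <= z < 1 ->
  is_derive (fun x => profile sI x / (1 + x ^ 2)) z
    (2 * logratio z * (1 - z ^ 2) / (1 + z ^ 2) ^ 2).
Proof.
intros hz; unfold profile; assert (hw := sqr_bounds z hz).
auto_derive.
- repeat split; (try apply ex_derive_logratio); nra.
- rewrite !Derive_logratio by nra.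
  field; repeat split; nra.
Qed.

Lemma profile_at_0 (A : symbol) : profile A 0 = 0.
Proof.
assert (e0 : 0 ^ 2 = 0) by ring.
destruct A; unfold profile; rewrite ?e0, ?Rplus_0_r, ?sqrt_1, ?logratio0; field.
Qed.

Lemma profile_combination_nonneg (A B C : symbol) (a b c : R) (dA dB dC : R -> R) (z : R) :
  0 <= z < 1 ->
  (forall x, 0 <= x < 1 -> is_derive (fun x => profile A x / (1 + x ^ 2)) x (dA x)) ->
  (forall x, 0 <= x < 1 -> is_derive (fun x => profile B x / (1 + x ^ 2)) x (dB x)) ->
  (forall x, 0 <= x < 1 -> is_derive (fun x => profile C x / (1 + x ^ 2)) x (dC x)) ->
  (forall x, 0 <= x < 1 -> 0 <= a * dA x + b * dB x + c * dC x) ->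
  0 <= a * profile A z + b * profile B z + c * profile C z.
Proof.
intros hz hA hB hC H.
set (f := fun A x => profile A x / (1 + x ^ 2)).
assert (h : 0 <= a * f A z + b * f B z + c * f C z).
{ apply (nonneg_of_derive_nonneg (fun x => a * f A x + b * f B x + c * f C x)
           (fun x => a * dA x + b * dB x + c * dC x)); trivial.
  - unfold f; rewrite !profile_at_0; field.
  - intros x hx; apply (is_derive_plus (fun x => a * f A x + b * f B x) (fun x => c * f C x)).
    + apply (is_derive_plus (fun x => a * f A x) (fun x => b * f B x));
        apply is_derive_scal; [apply hA | apply hB]; lra.
    + apply is_derive_scal, hC; lra. }
assert (e : forall A, profile A z = (1 + z ^ 2) * f A z).
{ intros A'; unfold f; field; nra. }
rewrite !e; nra.
Qed.

Lemma profile_Delta_le_I (z : R) : 0 <= z < 1 -> profile sDelta z <= profile sI z.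
Proof.
intros hz.
(* A two-term difference is cast in the three-term form with a zero coefficient. *)
assert (h : 0 <= 1 * profile sI z + -1 * profile sDelta z + 0 * profile sDelta z); [|lra].
apply (profile_combination_nonneg sI sDelta sDelta _ _ _ _ _ _ z hz is_derive_profile_I
         is_derive_profile_Delta is_derive_profile_Delta).
intros x hx; assert (hw := sqr_bounds x hx); assert (hl := logratio_ge x hx).
replace (_ + _) with
  (2 * (1 - x ^ 2) * (logratio x - 2 * x + logratio x * x ^ 2) / (1 + x ^ 2) ^ 3)
  by (field; nra).
apply Rdiv_le_0_compat; [|apply pow_lt; lra].
assert (2 * x <= logratio x) by nra.
assert (0 <= logratio x * x ^ 2) by (apply Rmult_le_pos; lra).
apply Rmult_le_pos; lra.
Qed.

Lemma profile_I_le_M1 (z : R) : 0 <= z < 1 -> profile sI z <= profile sM1 z.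
Proof.
intros hz.
assert (h : 0 <= 1 * profile sM1 z + -1 * profile sI z + 0 * profile sI z); [|lra].
apply (profile_combination_nonneg sM1 sI sI _ _ _ _ _ _ z hz is_derive_profile_M1
         is_derive_profile_I is_derive_profile_I).
intros x hx; assert (hw := sqr_bounds x hx); assert (hl := logratio_le x hx).
assert (hs := sqrt_1_plus_bounds (x ^ 2) ltac:(lra)).
replace (_ + _) with
  (2 * (2 * x * (2 - sqrt (1 + x ^ 2)) - logratio x * (1 - x ^ 2)) / (1 + x ^ 2) ^ 2)
  by (field; nra).
apply Rdiv_le_0_compat; [|apply pow_lt; lra].
(* The factor [1 - x^2] clears the denominator of [logratio_le]. *)
assert (h1 : logratio x * (1 - x ^ 2) <=
  2 * x * ((1 + x ^ 2 / 3) * (1 - x ^ 2) + (x ^ 2) ^ 2 / 5)).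
{ apply Rle_trans with
    (2 * x * (1 + x ^ 2 / 3 + x ^ 4 / (5 * (1 - x ^ 2))) * (1 - x ^ 2)); [nra|].
  right; field; lra. }
assert (h2 : 0 <= x * (2 - sqrt (1 + x ^ 2) -
                  ((1 + x ^ 2 / 3) * (1 - x ^ 2) + (x ^ 2) ^ 2 / 5))).
{ apply Rmult_le_pos; nra. }
lra.
Qed.

(** * Three-term combinations giving the inequalities with constants *)

(** Clearing denominators in [a D_FA <= b D_FB] gives [(b - a) F + a A - b B >= 0]; here
    [a : b = 8 : 9], and the later lemmas arise likewise. The coefficients sum to 0, which removes
    the common leading term [2 z^2] of all profiles. *)
Lemma profile_F_Delta_I (z : R) : 0 <= z < 1 ->
  0 <= 1 * profile sF z + 8 * profile sDelta z + -9 * profile sI z.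
Proof.
intros hz.
apply (profile_combination_nonneg sF sDelta sI _ _ _ _ _ _ z hz is_derive_profile_F
         is_derive_profile_Delta is_derive_profile_I).
intros x hx; assert (hw := sqr_bounds x hx); assert (hl := logratio_le x hx).
apply Rle_trans with
  (1 * (4 * x * (1 + 4 * x ^ 2 + x ^ 4) / (1 - x ^ 2) ^ 4) +
   8 * (4 * x * (1 - x ^ 2) / (1 + x ^ 2) ^ 3) +
   -9 * (2 * (2 * x * (1 + x ^ 2 / 3 + x ^ 4 / (5 * (1 - x ^ 2)))) *
         (1 - x ^ 2) / (1 + x ^ 2) ^ 2)).
- replace (x ^ 4) with ((x ^ 2) ^ 2) by ring.
  revert hw; generalize (x ^ 2); intros w hw.
  replace (_ + _) with
    (2 * x * (w ^ 2 * (612 - 736 * w + 884 * w ^ 2 - 316 * w ^ 3 + 24 * w ^ 4 + 12 * w ^ 5)) /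
      (5 * (1 - w) ^ 4 * (1 + w) ^ 3)) by (field; lra).
  apply Rdiv_le_0_compat.
  (* Since [w^3 <= w^2], the quintic is at least [612 - 736 w + 568 w^2], of negative
     discriminant. *)
  + assert (0 <= w ^ 2) by nra.
    assert (0 <= w ^ 3) by (apply pow_le; lra).
    assert (0 <= w ^ 4) by (apply pow_le; lra).
    assert (0 <= w ^ 5) by (apply pow_le; lra).
    repeat apply Rmult_le_pos; try lra; nra.
  + assert (0 < (1 - w) ^ 4) by (apply pow_lt; lra).
    assert (0 < (1 + w) ^ 3) by (apply pow_lt; lra); nra.
- assert (hc : 0 <= (1 - x ^ 2) / (1 + x ^ 2) ^ 2).
  { apply Rdiv_le_0_compat; [lra | apply pow_lt; lra]. }
  unfold Rdiv in *; nra.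
Qed.

Lemma profile_F_I_M1 (z : R) : 0 <= z < 1 ->
  0 <= 1 * profile sF z + 63 * profile sI z + -64 * profile sM1 z.
Proof.
intros hz.
apply (profile_combination_nonneg sF sI sM1 _ _ _ _ _ _ z hz is_derive_profile_F
         is_derive_profile_I is_derive_profile_M1).
intros x hx; assert (hw := sqr_bounds x hx); assert (hl := logratio_ge x hx).
assert (hs := sqrt_1_plus_bounds (x ^ 2) ltac:(lra)).
(* The combination increases with both [logratio x] and the square root, so lower bounds are
   substituted for both. *)
apply Rle_trans with
  (1 * (4 * x * (1 + 4 * x ^ 2 + x ^ 4) / (1 - x ^ 2) ^ 4) +
   63 * (2 * (2 * x * (1 + x ^ 2 / 3)) * (1 - x ^ 2) / (1 + x ^ 2) ^ 2) +
   -64 * (4 * x * (2 - (1 + x ^ 2 / 2 - (x ^ 2) ^ 2 / 8)) / (1 + x ^ 2) ^ 2)).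
- replace (x ^ 4) with ((x ^ 2) ^ 2) by ring.
  revert hw; generalize (x ^ 2); intros w hw.
  replace (_ + _) with
    (x * (w ^ 2 * (60 + 264 * w - 536 * w ^ 2 + 424 * w ^ 3 - 116 * w ^ 4)) /
      ((1 - w) ^ 4 * (1 + w) ^ 2)) by (field; lra).
  apply Rdiv_le_0_compat.
  (* Since [w^3 <= w^2], the quartic is at least [60 + w (264 - 536 w + 308 w^2)], whose quadratic
     factor has negative discriminant. *)
  + assert (0 <= w ^ 2) by nra.
    assert (0 <= w ^ 3) by (apply pow_le; lra).
    repeat apply Rmult_le_pos; try lra; nra.
  + apply Rmult_lt_0_compat; apply pow_lt; lra.
- assert (hc : 0 <= (1 - x ^ 2) / (1 + x ^ 2) ^ 2).
  { apply Rdiv_le_0_compat; [lra | apply pow_lt; lra]. }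
  assert (hc' : 0 <= x / (1 + x ^ 2) ^ 2).
  { apply Rdiv_le_0_compat; [lra | apply pow_lt; lra]. }
  assert (h1 := Rmult_le_compat_l _ _ _ hc hl).
  assert (h2 := Rmult_le_compat_l _ _ _ hc' (proj1 hs)).
  unfold Rdiv in *; lra.
Qed.

(* The three inequalities relating (F, M1, M2), (F, M2, h) and (F, h, M3) are all
   multiples of this one. *)
Lemma cube_sqrt_ineq (w : R) : 0 <= w < 1 ->
  0 <= 2 * w * (1 + w) ^ 2 / (1 - w) ^ 3 + 80 * (sqrt (1 + w) - 1) - 42 * w.
Proof.
intros hw; assert (hs := sqrt_1_plus_bounds w ltac:(lra)).
assert (es := pow2_sqrt (1 + w) ltac:(lra)).
(* A Padé bound: with [s = sqrt (1 + w)] one has [w = s^2 - 1] and [4 + w = s^2 + 3], and clearing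
   the denominator leaves [(s - 1)^3 >= 0]. *)
assert (h : 2 * w / (4 + w) <= sqrt (1 + w) - 1).
{ assert (0 <= (sqrt (1 + w) - 1) * (sqrt (1 + w) - 1) ^ 2).
  { apply Rmult_le_pos; nra. }
  apply Rle_div_l; nra. }
apply Rle_trans with
  (2 * w * (1 + w) ^ 2 / (1 - w) ^ 3 + 80 * (2 * w / (4 + w)) - 42 * w); [|lra].
replace (_ - _) with
  (2 * w * (w ^ 2 * (57 - 58 * w + 21 * w ^ 2)) / ((1 - w) ^ 3 * (4 + w))) by (field; lra).
apply Rdiv_le_0_compat.
- repeat apply Rmult_le_pos; nra.
- apply Rmult_lt_0_compat; [apply pow_lt|]; lra.
Qed.

Lemma profile_F_M1_M2 (z : R) : 0 <= z < 1 ->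
  0 <= 2 * profile sF z + 61 * profile sM1 z + -63 * profile sM2 z.
Proof.
intros hz; assert (h := cube_sqrt_ineq (z ^ 2) (sqr_bounds z hz)); unfold profile; lra.
Qed.

Lemma profile_F_M2_h (z : R) : 0 <= z < 1 ->
  0 <= 1 * profile sF z + 60 * profile sM2 z + -61 * profile sh z.
Proof.
intros hz; assert (h := cube_sqrt_ineq (z ^ 2) (sqr_bounds z hz)); unfold profile; lra.
Qed.

Lemma profile_F_h_M3 (z : R) : 0 <= z < 1 ->
  0 <= 1 * profile sF z + 19 * profile sh z + -20 * profile sM3 z.
Proof.
intros hz; assert (h := cube_sqrt_ineq (z ^ 2) (sqr_bounds z hz)); unfold profile; lra.
Qed.

Lemma profile_F_h_J (z : R) : 0 <= z < 1 ->
  0 <= 1 * profile sF z + 14 * profile sh z + -15 * profile sJ z.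
Proof.
intros hz; assert (hw := sqr_bounds z hz); assert (hl := logratio_le z hz).
unfold profile.
apply Rle_trans with
  (1 * (2 * z ^ 2 * (1 + z ^ 2) ^ 2 / (1 - z ^ 2) ^ 3) + 14 * (2 * z ^ 2) +
   -15 * (2 * z ^ 2 * (1 + z ^ 2 / 3 + z ^ 4 / (5 * (1 - z ^ 2))))); [|nra].
replace (z ^ 4) with ((z ^ 2) ^ 2) by ring.
revert hw; generalize (z ^ 2); intros w hw.
replace (_ + _) with
  (2 * w * (w ^ 2 * (10 - 8 * w + 2 * w ^ 2)) / (1 - w) ^ 3) by (field; lra).
apply Rdiv_le_0_compat; [|apply pow_lt; lra].
repeat apply Rmult_le_pos; nra.
Qed.

Lemma profile_F_J_K0 (z : R) : 0 <= z < 1 ->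
  0 <= 1 * profile sF z + 6 * profile sJ z + -7 * profile sK0 z.
Proof.
intros hz; assert (hw := sqr_bounds z hz); assert (hl := logratio_ge z hz).
unfold profile.
apply Rle_trans with
  (1 * (2 * z ^ 2 * (1 + z ^ 2) ^ 2 / (1 - z ^ 2) ^ 3) +
   6 * (2 * z ^ 2 * (1 + z ^ 2 / 3)) + -7 * (2 * z ^ 2 / (1 - z ^ 2))); [|nra].
revert hw; generalize (z ^ 2); intros w hw.
replace (_ + _) with
  (2 * w * (w ^ 2 * (6 - 2 * w ^ 2)) / (1 - w) ^ 3) by (field; lra).
apply Rdiv_le_0_compat; [|apply pow_lt; lra].
repeat apply Rmult_le_pos; nra.
Qed.

Lemma profile_F_M3_K0 (z : R) : 0 <= z < 1 ->
  0 <= 3 * profile sF z + 16 * profile sM3 z + -19 * profile sK0 z.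
Proof.
intros hz; assert (hw := sqr_bounds z hz); unfold profile.
revert hw; generalize (z ^ 2); intros w hw.
assert (hs := sqrt_1_plus_bounds w ltac:(lra)).
assert (es := pow2_sqrt (1 + w) ltac:(lra)).
(* The upper bound [1 + w/2] is wrong at order [w^2], where the combination must cancel. A sharper
   one comes from [s - 1 = w / (s + 1)] and the lower bound on [s]. *)
assert (h : sqrt (1 + w) - 1 <= 8 * w / (16 + 4 * w - w ^ 2)).
{ assert (0 <= (sqrt (1 + w) - 1) * (8 * (sqrt (1 + w) + 1) - (16 + 4 * w - w ^ 2))).
  { apply Rmult_le_pos; nra. }
  apply Rle_div_r; [nra | lra]. }
apply Rle_trans with
  (3 * (2 * w * (1 + w) ^ 2 / (1 - w) ^ 3) +
   16 * (4 * (w - 8 * w / (16 + 4 * w - w ^ 2))) + -19 * (2 * w / (1 - w))); [|lra].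
replace (_ + _) with
  (w * (w ^ 2 * (576 + 232 * w - 416 * w ^ 2 + 64 * w ^ 3)) /
    ((1 - w) ^ 3 * (16 + 4 * w - w ^ 2))) by (field; split; nra).
apply Rdiv_le_0_compat.
- assert (0 <= w ^ 3) by (apply pow_le; lra).
  repeat apply Rmult_le_pos; nra.
- apply Rmult_lt_0_compat; [apply pow_lt; lra | nra].
Qed.

Lemma profile_F_T_Psi (z : R) : 0 <= z < 1 ->
  0 <= 1 * profile sF z + 1 * profile sT z + -2 * profile sPsi z.
Proof.
intros hz; assert (hw := sqr_bounds z hz); unfold profile.
revert hw; generalize (z ^ 2); intros w hw.
assert (hl := logratio_ge w hw).
(* The weaker bound [2 w <= logratio w] is enough: its error has order [w^3], that is [z^6]. *)
apply Rle_trans with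
  (1 * (2 * w * (1 + w) ^ 2 / (1 - w) ^ 3) + 1 * ((1 + w) * (2 * w)) +
   -2 * (2 * w * (1 + w) / (1 - w) ^ 2)).
- replace (_ + _) with
    (2 * w * ((1 + w) * (w ^ 2 * (3 - w))) / (1 - w) ^ 3) by (field; lra).
  apply Rdiv_le_0_compat; [|apply pow_lt; lra].
  repeat apply Rmult_le_pos; nra.
- assert (0 <= w ^ 3) by (apply pow_le; lra); nra.
Qed.

Theorem mainTheorem2 (n : nat) (p q : nat -> R)
  (hn : (2 <= n)%nat)
  (hp : positive_distribution n p) (hq : positive_distribution n q) :
  (D sF sPsi n p q <= D sF sK0 n p q /\
   D sF sK0 n p q <= D sF sT n p q /\
   D sF sT n p q <= D sF sJ n p q /\
   D sF sJ n p q <= D sF sM3 n p q /\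
   D sF sM3 n p q <= D sF sh n p q /\
   D sF sh n p q <= D sF sM2 n p q /\
   D sF sM2 n p q <= D sF sM1 n p q /\
   D sF sM1 n p q <= D sF sI n p q /\
   D sF sI n p q <= D sF sDelta n p q) /\
  (D sF sDelta n p q <= 9 / 8 * D sF sI n p q /\
   9 / 8 * D sF sI n p q <= 8 / 7 * D sF sM1 n p q /\
   8 / 7 * D sF sM1 n p q <= 72 / 61 * D sF sM2 n p q /\
   72 / 61 * D sF sM2 n p q <= 6 / 5 * D sF sh n p q) /\
  (6 / 5 * D sF sh n p q <= 9 / 7 * D sF sJ n p q /\
   9 / 7 * D sF sJ n p q <= 3 / 2 * D sF sK0 n p q) /\
  (6 / 5 * D sF sh n p q <= 24 / 19 * D sF sM3 n p q /\
   24 / 19 * D sF sM3 n p q <= 3 / 2 * D sF sK0 n p q) /\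
  (3 / 2 * D sF sK0 n p q <= 3 / 2 * D sF sT n p q /\
   3 / 2 * D sF sT n p q <= 3 * D sF sPsi n p q).
Proof.
destruct hp as [hp _], hq as [hq _].
assert (h1 : (1 <= n)%nat) by lia.
assert (le : forall A B, (forall z, 0 <= z < 1 -> profile A z <= profile B z) ->
  normalized A n p q <= normalized B n p q).
{ intros A B; apply normalized_le; trivial. }
assert (comb := fun A B C a b c =>
  normalized_combination_nonneg A B C a b c n p q h1 hp hq).
assert (hK0Psi := le _ _ profile_K0_le_Psi).
assert (hTK0 := le _ _ profile_T_le_K0).
assert (hJT := le _ _ profile_J_le_T).
assert (hM3J := le _ _ profile_M3_le_J).
assert (hhM3 := le _ _ (fun z _ => profile_h_le_M3 z)).
assert (hM2h := le _ _ (fun z _ => profile_M2_le_h z)).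
assert (hM1M2 := le _ _ (fun z _ => profile_M1_le_M2 z)).
assert (hIM1 := le _ _ profile_I_le_M1).
assert (hDeltaI := le _ _ profile_Delta_le_I).
assert (hFDeltaI := comb _ _ _ _ _ _ profile_F_Delta_I).
assert (hFIM1 := comb _ _ _ _ _ _ profile_F_I_M1).
assert (hFM1M2 := comb _ _ _ _ _ _ profile_F_M1_M2).
assert (hFM2h := comb _ _ _ _ _ _ profile_F_M2_h).
assert (hFhJ := comb _ _ _ _ _ _ profile_F_h_J).
assert (hFJK0 := comb _ _ _ _ _ _ profile_F_J_K0).
assert (hFhM3 := comb _ _ _ _ _ _ profile_F_h_M3).
assert (hFM3K0 := comb _ _ _ _ _ _ profile_F_M3_K0).
assert (hFTPsi := comb _ _ _ _ _ _ profile_F_T_Psi).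
(* Subtraction from F reverses the pairwise order, and every claim is now linear in the normalized
   quantities. *)
unfold D; repeat split; lra.
Qed.
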